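(* Let $\mathcal U$ be an ultrafilter defined on a set $\mathcal I$, let $X_i$, $i\in\mathcal I$, be a collection of real Banach spaces and let $X$ be the corresponding ultraproduct of the $X_i$. Then the following assertions are equivalent: (1) $X$ has the Daugavet property. (2) For every $\varepsilon>0$ there exists some $n\in\mathbb{N}$ such that the set of all $i\in\mathcal I$ for which $D_{X_i}(\varepsilon)<n$ belongs to the ultrafilter $\mathcal U$.
   Context: All Banach spaces are real; $S(X)$ is the unit sphere of $X$. A Banach space $X$ has the Daugavet property if $\|\mathrm{Id}+T\|=1+\|T\|$ for every bounded rank-$1$ linear operator $T: X\to X$. The ultraproduct of $(X_i)$ along $\mathcal U$ is the quotient of the space of bounded families $(x_i)$, $x_i\in X_i$, by the subspace of families with $\lim_{\mathcal U}\|x_i\|=0$, with norm $\|(x_i)\|=\lim_{\mathcal U}\|x_i\|$. For a Banach space $X$, $x\in S(X)$ and $\varepsilon>0$ put $l^+(x,\varepsilon)=\{y\in X: \|y\|\le 1+\varepsilon,\ \|x+y\|>2-\varepsilon\}$. For $A\subset X$, $\mathrm{conv}_n(A)$ is the set of all convex combinations of all $n$-point collections of elements of $A$. Define $D_X(\varepsilon)=\inf\{n\in\mathbb{N}: \mathrm{conv}_n(l^+(x,\varepsilon))\supset S(X)\ \text{for all } x\in S(X)\}$, with $\inf\emptyset=\infty$.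
   Formalization: The ultrafilter is assumed countably incomplete (for countable index sets: nonprincipal); for a principal ultrafilter the ultraproduct is a single factor, and a Daugavet space with infinite index D (Kadets–Werner) satisfies (1) but not (2). *)

(* Defs.v *)
From HB Require Import structures.
From mathcomp Require Import all_boot all_order all_algebra.
From mathcomp Require Import ring_quotient.
From mathcomp Require Import all_classical all_reals all_analysis.

Set Implicit Arguments.
Unset Strict Implicit.
Unset Printing Implicit Defensive.

Import Order.TTheory GRing.Theory Num.Theory.
Import numFieldNormedType.Exports.

Local Open Scope classical_set_scope.
Local Open Scope ring_scope.

Section Families.
Context {R : realType} {I : Type}.
Implicit Type X : I -> completeNormedModType R.

Definition family X := forall i, X i.

Section Lmodule.
Variable X : I -> completeNormedModType R.

HB.instance Definition _ := Choice.on (family X).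

Let add (x y : family X) : family X := fun i => x i + y i.
Let opp (x : family X) : family X := fun i => - x i.
Let zero : family X := fun i => 0.
Let scale (a : R) (x : family X) : family X := fun i => a *: x i.

Fact family_addA : associative add.
Proof. by move=> x y z; apply: functional_extensionality_dep => i; exact: addrA. Qed.
Fact family_addC : commutative add.
Proof. by move=> x y; apply: functional_extensionality_dep => i; exact: addrC. Qed.
Fact family_add0 : left_id zero add.
Proof. by move=> x; apply: functional_extensionality_dep => i; exact: add0r. Qed.
Fact family_addN : left_inverse zero opp add.
Proof. by move=> x; apply: functional_extensionality_dep => i; exact: addNr. Qed.

HB.instance Definition _ := GRing.isZmodule.Build (family X)
  family_addA family_addC family_add0 family_addN.

Fact family_scaleA (a b : R) (x : family X) :
  scale a (scale b x) = scale (a * b) x.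
Proof. by apply: functional_extensionality_dep => i; exact: scalerA. Qed.
Fact family_scale1 : left_id 1 scale.
Proof. by move=> x; apply: functional_extensionality_dep => i; exact: scale1r. Qed.
Fact family_scaleDr : right_distributive scale +%R.
Proof. by move=> a x y; apply: functional_extensionality_dep => i; exact: scalerDr. Qed.
Fact family_scaleDl (x : family X) : {morph scale^~ x : a b / a + b}.
Proof. by move=> a b; apply: functional_extensionality_dep => i; exact: scalerDl. Qed.

HB.instance Definition _ := GRing.Zmodule_isLmodule.Build R (family X)
  family_scaleA family_scale1 family_scaleDr family_scaleDl.

Lemma familyZDE (a : R) (x y : family X) i : (a *: x + y) i = a *: x i + y i.
Proof. by []. Qed.

End Lmodule.

Definition is_bounded X : {pred family X} :=
  fun x => `[< exists M : R, forall i, `|x i| <= M >].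
Arguments is_bounded : clear implicits.

Section Bounded.
Variable X : I -> completeNormedModType R.

Fact is_bounded_submod : submod_closed (is_bounded X).
Proof.
split.
  by apply/asboolP; exists 0 => i; rewrite (_ : (0 : family X) i = 0) ?normr0.
move=> a x y /asboolP[M xM] /asboolP[N yN]; apply/asboolP.
exists (`|a| * M + N) => i; rewrite familyZDE.
apply: (le_trans (ler_normD _ _)); rewrite normrZ lerD ?ler_wpM2l ?xM ?yN ?normr_ge0 //.
Qed.

HB.instance Definition _ := GRing.isSubmodClosed.Build R (family X)
  (is_bounded X) is_bounded_submod.

Record bounded_family := BoundedFamily {
  bounded_family_val : family X ;
  bounded_familyP : bounded_family_val \in is_bounded X }.

HB.instance Definition _ := [isSub for bounded_family_val].
HB.instance Definition _ := [Choice of bounded_family by <:].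
HB.instance Definition _ := [SubChoice_isSubLmodule of bounded_family by <:].

End Bounded.
End Families.

Section Ultraproduct.
Context {R : realType} {I : Type}.
Variables (U : set_system I) (UU : UltraFilter U).
Variable X : I -> completeNormedModType R.

Definition limnorm (x : bounded_family X) : R := lim (`|val x i| @[i --> U]).

Lemma limnorm_cvg (x : bounded_family X) : `|val x i| @[i --> U] --> limnorm x.
Proof.
have /asboolP[M xM] := bounded_familyP x.
suff : cvg (`|val x i| @[i --> U]) by [].
pose f i : R := `|val x i|.
have fUltra : UltraFilter (f @ U).
  split=> [|G PG UG]; first exact: fmap_proper_filter.
  apply/seteqP; split => // A GA.
  have [//|UA] := in_ultra_setVsetC (f @^-1` A) UU.
  have {}UA : G (~` A) by apply: UG.
  by have [z []] := filter_ex (filterI GA UA).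
have := @segment_compact R 0 M; rewrite compact_ultra => /(_ _ fUltra).
case=> [|l [_ fl]]; last by apply/cvg_ex; exists l.
apply: (@filterE _ U) => i; rewrite /preimage/= in_itv/= /f; apply/andP; split.
  exact: normr_ge0.
exact: xM.
Qed.

Lemma limnorm_unique (x : bounded_family X) (l : R) :
  `|val x i| @[i --> U] --> l -> limnorm x = l.
Proof. by move=> xl; apply: (cvg_unique _ (@limnorm_cvg x) xl). Qed.

Lemma limnorm_ge0 x : 0 <= limnorm x.
Proof.
apply: limr_ge; first exact: limnorm_cvg.
by apply: (@filterE _ U) => i; exact: normr_ge0.
Qed.

Lemma limnormD x y : limnorm (x + y) <= limnorm x + limnorm y.
Proof.
have := cvgB (cvgD (@limnorm_cvg x) (@limnorm_cvg y)) (@limnorm_cvg (x + y)).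
move=> /(_ _ _) cvgs.
rewrite -subr_ge0 -(cvg_lim _ cvgs)//; apply: limr_ge.
  by apply/cvg_ex; eexists; exact: cvgs.
by apply: (@filterE _ U) => i; rewrite subr_ge0; exact: ler_normD.
Qed.

Lemma limnormZ (a : R) x : limnorm (a *: x) = `|a| * limnorm x.
Proof.
apply: limnorm_unique.
rewrite (_ : (fun i => _) = fun i => `|a| * `|val x i|); last first.
  by apply/funext => i; exact: normrZ.
exact: cvgMr (@limnorm_cvg x).
Qed.

Definition null_family : {pred bounded_family X} := fun x => limnorm x == 0.

Fact null_family_submod : submod_closed null_family.
Proof.
split.
  by rewrite unfold_in -[0]/(0 : bounded_family X) -(scale0r 0) limnormZ normr0 mul0r.
move=> a x y /eqP x0 /eqP y0; rewrite unfold_in eq_le limnorm_ge0 andbT.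
by rewrite (le_trans (limnormD _ _))// limnormZ x0 y0 mulr0 addr0.
Qed.

HB.instance Definition _ := GRing.isSubmodClosed.Build R (bounded_family X)
  null_family null_family_submod.

Local Open Scope quotient_scope.

Definition ultraproduct := Quotient.quot null_family.

HB.instance Definition _ := GRing.Zmodule.on ultraproduct.
HB.instance Definition _ := ZmodQuotient.on ultraproduct.

Definition uproj (x : bounded_family X) : ultraproduct := \pi x.

Lemma uprojP (x y : bounded_family X) :
  reflect (uproj x = uproj y) (limnorm (x - y) == 0).
Proof.
rewrite -[_ == 0]/(x - y \in null_family) Quotient.idealrBE.
exact: eqP.
Qed.

Lemma uprojD x y : uproj (x + y) = uproj x + uproj y.
Proof. exact: Quotient.pi_add. Qed.

Lemma uproj_repr (q : ultraproduct) : uproj (repr q) = q.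
Proof. exact: reprK. Qed.

Definition ultraproduct_scale (a : R) (q : ultraproduct) : ultraproduct :=
  uproj (a *: repr q).

Lemma uproj_scale a x : ultraproduct_scale a (uproj x) = uproj (a *: x).
Proof.
apply/uprojP; rewrite -scalerBr limnormZ.
have /uprojP/eqP -> := uproj_repr (uproj x).
by rewrite mulr0.
Qed.

Fact ultraproduct_scaleA a b q :
  ultraproduct_scale a (ultraproduct_scale b q) = ultraproduct_scale (a * b) q.
Proof. by rewrite -[q]uproj_repr !uproj_scale scalerA. Qed.
Fact ultraproduct_scale1 : left_id 1 ultraproduct_scale.
Proof. by move=> q; rewrite -[q]uproj_repr uproj_scale scale1r. Qed.
Fact ultraproduct_scaleDr : right_distributive ultraproduct_scale +%R.
Proof.
move=> a q r; rewrite -[q]uproj_repr -[r]uproj_repr -uprojD !uproj_scale.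
by rewrite scalerDr uprojD.
Qed.
Fact ultraproduct_scaleDl q : {morph ultraproduct_scale^~ q : a b / a + b}.
Proof.
by move=> a b /=; rewrite -[q]uproj_repr !uproj_scale scalerDl uprojD.
Qed.

HB.instance Definition _ := GRing.Zmodule_isLmodule.Build R ultraproduct
  ultraproduct_scaleA ultraproduct_scale1 ultraproduct_scaleDr
  ultraproduct_scaleDl.

Lemma uprojZ a x : uproj (a *: x) = a *: uproj x.
Proof. exact/esym/uproj_scale. Qed.

Definition ultraproduct_norm (q : ultraproduct) : R := limnorm (repr q).

Lemma ultraproduct_norm_uproj x : ultraproduct_norm (uproj x) = limnorm x.
Proof.
have le u v : uproj u = uproj v -> limnorm u <= limnorm v.
  move=> /uprojP/eqP uv; rewrite -[u](subrK v).
  by rewrite (le_trans (limnormD _ _))// uv add0r.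
by apply/eqP; rewrite eq_le !le// uproj_repr.
Qed.

Fact ultraproduct_normD q r :
  ultraproduct_norm (q + r) <= ultraproduct_norm q + ultraproduct_norm r.
Proof.
rewrite -[q]uproj_repr -[r]uproj_repr -uprojD !ultraproduct_norm_uproj.
exact: limnormD.
Qed.
Fact ultraproduct_normZ (a : R) q :
  ultraproduct_norm (a *: q) = `|a| * ultraproduct_norm q.
Proof.
by rewrite -[q]uproj_repr -uprojZ !ultraproduct_norm_uproj limnormZ.
Qed.
Fact ultraproduct_norm0_eq0 q : ultraproduct_norm q = 0 -> q = 0.
Proof.
rewrite -[q]uproj_repr ultraproduct_norm_uproj => q0.
rewrite -(scale0r q) -[q in RHS]uproj_repr -uprojZ scale0r; apply/uprojP.
by rewrite subr0 q0.
Qed.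

HB.instance Definition _ := Lmodule_isNormed.Build R ultraproduct
  ultraproduct_normD ultraproduct_normZ ultraproduct_norm0_eq0.

Lemma norm_uproj x : `|uproj x| = lim (`|val x i| @[i --> U]).
Proof. exact: ultraproduct_norm_uproj. Qed.

Lemma uproj_surj (q : ultraproduct) : exists x, uproj x = q.
Proof. by exists (repr q); exact: uproj_repr. Qed.

End Ultraproduct.
Arguments ultraproduct {R I} U {UU} X.

Section Daugavet.
Context {R : realType} (X : normedModType R).

(* [opnorm T] is meaningful only when [T] is a bounded operator, since [sup] is
   0 on unbounded sets. *)
Definition opnorm (T : X -> X) : R := sup [set `|T x| | x in [set x | `|x| <= 1]].

Definition bounded_operator (T : X -> X) : Prop :=
  exists M : R, forall x, `|T x| <= M * `|x|.

(* The zero operator is not of rank 1. *)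
Definition rank_one (T : X -> X) : Prop :=
  exists2 v : X, v != 0 & range T = [set a *: v | a in [set: R]].

Definition daugavet : Prop := forall T : {linear X -> X},
  bounded_operator T -> rank_one T -> opnorm (idfun \+ T) = 1 + opnorm T.

Definition unit_sphere : set X := [set x | `|x| = 1].

Definition lplus (x : X) (e : R) : set X :=
  [set y | `|y| <= 1 + e /\ `|x + y| > 2 - e].

(* The points of an n-point collection may be repeated. *)
Definition conv_n (n : nat) (A : set X) : set X :=
  [set y | exists (a : 'I_n -> X) (w : 'I_n -> R),
    [/\ forall k, A (a k), forall k, 0 <= w k, \sum_k w k = 1
      & y = \sum_k w k *: a k]].

(* Extended-real valued, because [ereal_inf set0 = +oo]. *)
Definition daugavet_index (e : R) : \bar R :=
  ereal_inf [set n%:R%:E | n in [set n : nat |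
    forall x, unit_sphere x -> unit_sphere `<=` conv_n n (lplus x e)]].

End Daugavet.

(* On a countable index set these are exactly the nonprincipal ultrafilters.
   Principal ultrafilters are excluded: along one of them the ultraproduct is a
   single factor, and Daugavet spaces with an infinite index exist. *)
Definition countably_incomplete {I : Type} (U : set_system I) : Prop :=
  exists A : nat -> set I, (forall n, U (A n)) /\ ~ U (\bigcap_n A n).

(* Main.v *)
From HB Require Import structures.
Require Import Defs.
From mathcomp Require Import all_boot all_order all_algebra.
From mathcomp Require Import all_classical all_reals all_analysis.
From mathcomp Require Import lra.
Import Order.TTheory GRing.Theory Num.Theory.
Import numFieldNormedType.Exports.
Local Open Scope classical_set_scope.
Local Open Scope ring_scope.

(** The Daugavet property has a geometric form, [daugavetP]: for all unit vectors
    [x], [y] and every [e > 0], the vector [y] is a convex combination of points of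
    [lplus x e]. Neither direction bounds the number of points. The index
    [daugavet_index X e] below [n] says that [n] points always suffice, so the
    theorem asserts that in an ultraproduct the number of points is automatically
    uniform.

    The geometric form rests on the Hahn-Banach theorem. If [y] is far from the
    convex combinations of points of [lplus x e], a functional separates it from
    them ([conv_separation]), and the Daugavet equation for the rank-one operator
    made of this functional and [x] yields a point of [lplus x e] on the wrong side.
    The converse is an averaging argument. Approximate representations can be made
    exact by a translation ([conv_n_lplus_near]), so closures never appear.

    Being a combination of [n] points of [lplus x e], with [n] fixed, passes from
    [U]-almost all factors to the ultraproduct ([conv_lplus_uproj]) and back
    ([conv_lplus_near_of_uproj]), after an arbitrarily small increase of [e]. A bound
    on the indices of [U]-almost all factors therefore gives the geometric form for
    the ultraproduct. Conversely, if no bound holds, then for each [n] almost all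
    factors contain a pair of unit vectors that fails with [n] points. Countable
    incompleteness merges these into a single family of pairs that fails, for each
    [n], at almost all indices ([diagonal_choice]); the two classes in the
    ultraproduct then violate the geometric form. *)

Set Implicit Arguments.
Unset Strict Implicit.

(** * The Hahn-Banach theorem *)

Section Sublinear.
Context {R : realType} {V : lmodType R}.
Implicit Types (p f : V -> R) (C : set (V * R)).

(** Homogeneity is only required as an inequality: applied to [t] and [t^-1] it
    gives the equality, and infima need to be checked in one direction only. *)
Definition sublinear p :=
  (forall x y, p (x + y) <= p x + p y) /\
  (forall t x, 0 < t -> p (t *: x) <= t * p x).

Definition convex_cone C :=
  [/\ C (0, 0),
      forall c d, C c -> C d -> C (c.1 + d.1, c.2 + d.2) &
      forall t c, 0 < t -> C c -> C (t *: c.1, t * c.2)].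

Lemma le_addr_inf (A B : set R) (l : R) : A !=set0 -> B !=set0 ->
  (forall a b, A a -> B b -> l <= a + b) -> l <= inf A + inf B.
Proof.
move=> A0 B0 lAB; rewrite -lerBlDr; apply: lb_le_inf => // a Aa.
rewrite lerBlDr -lerBlDl; apply: lb_le_inf => // b Bb.
by rewrite lerBlDl lAB.
Qed.

Lemma sublinear0 p : sublinear p -> p 0 = 0.
Proof.
move=> [_ pZ].
have := pZ 2 0 (ltr0n _ 2); have := pZ 2^-1 0; rewrite !scaler0.
by rewrite invr_gt0 ltr0n => /(_ isT); lra.
Qed.

Lemma sublinear_geN p x : sublinear p -> - p (- x) <= p x.
Proof.
move=> sp; have [pD _] := sp; have := pD x (- x).
by rewrite subrr sublinear0 //; lra.
Qed.

Section Improve.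
Variables (p : V -> R) (C : set (V * R)).
Hypotheses (sp : sublinear p) (cC : convex_cone C).
Hypothesis Cp : forall c, C c -> c.2 <= p c.1.

Let vals z := [set p (z + c.1) - c.2 | c in C].

(** The largest sublinear function below [p] that is at most [- c.2] at [- c.1]
    for every [c] in the cone [C]. A linear functional below it is thus below [p]
    and at least [c.2] at every [c.1]. *)
Definition improve z := inf (vals z).

Let vals_nonempty z : vals z !=set0.
Proof. by have [C0 _ _] := cC; exists (p (z + 0) - 0), (0, 0). Qed.

Let vals_lbound z : has_lbound (vals z).
Proof.
exists (- p (- z)) => _ [c Cc <-]; have [pD _] := sp.
have := pD (z + c.1) (- z); rewrite addrAC subrr add0r.
by have := Cp Cc; lra.
Qed.

Lemma improve_le z c : C c -> improve z <= p (z + c.1) - c.2.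
Proof. by move=> Cc; apply: (ge_inf (vals_lbound z)); exists c. Qed.

Lemma improve_le_id z : improve z <= p z.
Proof.
have [C0 _ _] := cC.
by have := improve_le z C0; rewrite addr0 subr0.
Qed.

Lemma sublinear_improve : sublinear improve.
Proof.
have [_ CD CZ] := cC; have [pD pZ] := sp; split.
  move=> x y; apply: le_addr_inf => // _ _ [c Cc <-] [d Cd <-].
  have := improve_le (x + y) (CD _ _ Cc Cd) => /=.
  have := pD (x + c.1) (y + d.1); rewrite addrACA; lra.
move=> t x t0; rewrite mulrC -ler_pdivrMr //; apply: lb_le_inf => // _ [c Cc <-].
rewrite ler_pdivrMr //; apply: le_trans (improve_le _ (CZ _ _ t0 Cc)) _ => /=.
have := pZ t (x + c.1) t0; rewrite scalerDr; lra.
Qed.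

End Improve.

(** Zorn's lemma applies because the pointwise infimum of a chain of sublinear
    functions is sublinear, and is finite since [- p (- x)] bounds every sublinear
    function below [p] from below at [x]. *)
Lemma minimal_sublinear p : sublinear p ->
  exists f, [/\ sublinear f, forall x, f x <= p x &
    forall g, sublinear g -> (forall x, g x <= f x) -> g = f].
Proof.
move=> sp.
pose T := {f : V -> R | sublinear f /\ forall x, f x <= p x}.
pose rel (f g : T) := `[< forall x, sval g x <= sval f x >].
have [||||[f [sf fp]] fmin] := @Zorn T rel.
- by move=> f; apply/asboolP.
- move=> f g h /asboolP fg /asboolP gh; apply/asboolP => x.
  exact: le_trans (gh x) (fg x).
- move=> [f Pf] [g Pg] /asboolP/= fg /asboolP/= gf; apply: eq_exist.
  by apply/funext => x; apply/eqP; rewrite eq_le fg gf.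
- move=> A Atot; have [[f0 Af0]|A0] := pselect (A !=set0); last first.
    exists (exist _ p (conj sp (fun x => lexx (p x)))) => s As.
    by case: A0; exists s.
  pose vals x := [set sval f x | f in A].
  pose g x := inf (vals x).
  have vals0 x : vals x !=set0 by exists (sval f0 x), f0.
  have gle (f : T) x : A f -> g x <= sval f x.
    move=> Af; apply: ge_inf; last by exists f.
    exists (- p (- x)) => _ [[h [sh hp]] _ <-] /=.
    by have := sublinear_geN x sh; have := hp (- x); lra.
  have sg : sublinear g.
    split=> [x y|t x t0].
      apply: le_addr_inf => // _ _ [f Af <-] [h Ah <-].
      have [/asboolP fh|/asboolP hf] := Atot f h Af Ah.
      + have [[hD _] _] := svalP h.
        apply: le_trans (gle h _ Ah) _; apply: le_trans (hD _ _) _.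
        exact: lerD.
      + have [[fD _] _] := svalP f.
        apply: le_trans (gle f _ Af) _; apply: le_trans (fD _ _) _.
        exact: lerD.
    rewrite mulrC -ler_pdivrMr //; apply: lb_le_inf => // _ [f Af <-].
    have [[_ fZ] _] := svalP f.
    rewrite ler_pdivrMr // mulrC; apply: le_trans (gle f _ Af) _; exact: fZ.
  have gp x : g x <= p x.
    by have [_ fp] := svalP f0; apply: le_trans (gle _ _ Af0) (fp x).
  by exists (exist _ g (conj sg gp)) => f Af; apply/asboolP => x; exact: gle.
exists f; split=> // g sg gf.
have gp x : g x <= p x by apply: le_trans (gf x) (fp x).
have := fmin (exist _ g (conj sg gp)).
by move=> /(_ (asboolT gf))/(congr1 sval).
Qed.

(** Improving [f] by the ray through [(y, f y)] does not change it, by minimality;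
    this is the inequality [f x <= f (x + y) - f y]. *)
Lemma minimal_sublinearD f :
  sublinear f -> (forall g, sublinear g -> (forall x, g x <= f x) -> g = f) ->
  forall x y, f (x + y) = f x + f y.
Proof.
move=> sf fmin x y; have [fD fZ] := sf.
pose C : set (V * R) := [set c | exists2 t, 0 <= t & c = (t *: y, t * f y)].
have cC : convex_cone C.
  split=> [|_ _ [t t0 ->] [s s0 ->]|t _ t0 [s s0 ->]] /=.
  - by exists 0; rewrite ?scale0r ?mul0r.
  - by exists (t + s); rewrite ?addr_ge0 // scalerDl mulrDl.
  - by exists (t * s); rewrite ?mulr_ge0 ?(ltW t0) // scalerA mulrA.
have Cf c : C c -> c.2 <= f c.1.
  move=> [t]; rewrite le_eqVlt => /predU1P[<-|t0] -> /=.
    by rewrite scale0r mul0r sublinear0.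
  have := fZ t^-1 (t *: y); rewrite invr_gt0 scalerA mulVf ?gt_eqF // scale1r.
  by move=> /(_ t0); rewrite mulrC ler_pdivlMr // mulrC.
have fC := fmin _ (sublinear_improve sf cC Cf) (improve_le_id sf cC Cf).
have : C (y, f y) by exists 1; rewrite ?scale1r ?mul1r.
move=> /(improve_le sf Cf x); rewrite fC /=.
by have := fD x y; lra.
Qed.

(** A minimal sublinear function is linear, so any one below [improve p C] does.
    The cone of lower bounds makes this version serve directly as a separation
    theorem, without the gauge of a convex set. *)
Lemma hahn_banach_cone p C : sublinear p -> convex_cone C ->
  (forall c, C c -> c.2 <= p c.1) ->
  exists f : {scalar V},
    (forall x, f x <= p x) /\ (forall c, C c -> c.2 <= f c.1).
Proof.
move=> sp cC Cp.
have [f [sf fq fmin]] := minimal_sublinear (sublinear_improve sp cC Cp).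
have fD := minimal_sublinearD sf fmin; have [_ fZ] := sf.
have f0 := sublinear0 sf.
have fN x : f (- x) = - f x.
  by apply/eqP; rewrite -addr_eq0 -fD addNr f0.
have fZp t x : 0 < t -> f (t *: x) = t * f x.
  move=> t0; apply/eqP; rewrite eq_le fZ //=.
  by have := fZ t (- x) t0; rewrite scalerN !fN mulrN lerN2.
have fS : scalable_for *%R f.
  move=> t x; have [t0|t0|->] := ltrgt0P t; first exact: fZp.
    by rewrite -[t]opprK scaleNr fN fZp ?oppr_gt0 // !mulNr.
  by rewrite scale0r mul0r.
pose F : {scalar V} := HB.pack_for {scalar V} f
  (GRing.isNmodMorphism.Build _ _ f (conj f0 fD)) (GRing.isScalable.Build _ _ _ _ f fS).
exists F; split=> [x|c Cc].
  exact: le_trans (fq x) (improve_le_id sp cC Cp x).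
have := le_trans (fq (- c.1)) (improve_le sp Cp _ Cc).
by rewrite addNr sublinear0 // fN -[F c.1]/(f c.1); lra.
Qed.

End Sublinear.

(** * Convex combinations *)

Section Convex.
Context {R : realType} {X : normedModType R}.
Implicit Types (A : set X) (x y z : X).

(** The [n]-point collections may repeat points, so a combination of [m] points is
    padded with points of weight 0; for [m] equal to 0 there is none. *)
Lemma conv_n_le m n A : (m <= n)%N -> conv_n m A `<=` conv_n n A.
Proof.
elim: n => [|n IH]; first by rewrite leqn0 => /eqP ->.
rewrite leq_eqVlt => /predU1P[-> //|]; rewrite ltnS => /IH{}IH y /IH.
move=> [a [w [Aa w0 w1 ->]]].
have [n0|n_gt0] := posnP n.
  by subst n; move: w1; rewrite big_ord0 => /esym/eqP; rewrite oner_eq0.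
pose k0 := Ordinal n_gt0.
exists (fun k => if unlift ord0 k is Some j then a j else a k0).
exists (fun k => if unlift ord0 k is Some j then w j else 0); split.
- by move=> k; case: unliftP.
- by move=> k; case: unliftP.
- rewrite big_ord_recl unlift_none add0r -[RHS]w1.
  by apply: eq_bigr => j _; rewrite liftK.
- rewrite big_ord_recl unlift_none scale0r add0r.
  by apply: eq_bigr => j _; rewrite liftK.
Qed.

(** Translating all the points of the combination by [y - z] turns an approximation
    of [y] into an exact representation, at the cost of enlarging [lplus x e]. This
    is why no closures of convex hulls are needed. *)
Lemma conv_n_lplus_near n x y z (e d : R) :
  conv_n n (lplus x e) z -> `|y - z| <= d -> conv_n n (lplus x (e + d)) y.
Proof.
move=> [a [w [xa w0 w1 zE]]] yz.
exists (fun k => a k + (y - z)), w; split=> // [k|].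
  have [ae xae] := xa k; split.
    by apply: le_trans (ler_normD _ _) _; rewrite addrA lerD.
  have := ler_normB (x + (a k + (y - z))) (y - z).
  by rewrite addrA addrK; move: xae yz; lra.
under eq_bigr do rewrite scalerDr.
by rewrite big_split /= -scaler_suml w1 scale1r -zE addrC subrK.
Qed.

(** Hahn-Banach is applied to the norm and to the convex cone generated by the
    pairs [(y - a, d)] with [a] in [A]: that such a pair [(u, s)] satisfies
    [s <= `|u|] is the distance hypothesis, up to normalizing the weights. *)
Lemma conv_separation A y (d : R) :
  (forall n z, conv_n n A z -> d <= `|y - z|) ->
  exists f : {scalar X}, (forall u, `|f u| <= `|u|) /\
    (forall a, A a -> f a + d <= f y).
Proof.
move=> dA.
pose C : set (X * R) := [set c | exists2 l : seq (R * X),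
  (forall p, p \in l -> 0 <= p.1 /\ A p.2) &
  c = (\sum_(p <- l) p.1 *: (y - p.2), d * \sum_(p <- l) p.1)].
have sp : sublinear (fun u : X => `|u|).
  by split=> [u v|t u t0]; [exact: ler_normD|rewrite normrZ gtr0_norm].
have cC : convex_cone C.
  split=> [|_ _ [l lA ->] [k kA ->]|t _ t0 [l lA ->]] /=.
  - by exists [::]; rewrite ?big_nil ?mulr0.
  - exists (l ++ k); last by rewrite !big_cat mulrDr.
    by move=> p; rewrite mem_cat => /orP[/lA|/kA].
  - exists [seq (t * p.1, p.2) | p <- l].
      move=> _ /mapP[p /lA[p0 Ap] ->] /=; split=> //.
      by rewrite mulr_ge0 // ltW.
    rewrite !big_map /= scaler_sumr -mulr_sumr mulrCA.
    by congr pair; apply: eq_bigr => p _; rewrite scalerA.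
have Cp c : C c -> c.2 <= `|c.1|.
  move=> [l lA ->] /=; set s := \sum_(p <- l) p.1.
  have : 0 <= s by rewrite /s big_seq sumr_ge0 // => p /lA[].
  rewrite le_eqVlt => /predU1P[<-|s0]; first by rewrite mulr0.
  pose z := \sum_(p <- l) (p.1 / s) *: p.2.
  have /dA dz : conv_n (size l) A z.
    exists (fun k => (tnth (in_tuple l) k).2).
    exists (fun k => (tnth (in_tuple l) k).1 / s); split.
    - by move=> k; have [] := lA _ (mem_tnth k (in_tuple l)).
    - by move=> k; have [? _] := lA _ (mem_tnth k (in_tuple l)); rewrite divr_ge0 // ltW.
    - rewrite -mulr_suml (_ : \sum_k _ = s) ?divff ?gt_eqF //.
      by rewrite /s [RHS]big_tnth.
    - by rewrite /z big_tnth.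
  have -> : \sum_(p <- l) p.1 *: (y - p.2) = s *: (y - z).
    rewrite scalerBr /s scaler_suml /z scaler_sumr -sumrB.
    apply: eq_bigr => p _.
    by rewrite scalerBr scalerA -/s mulrC divfK // gt_eqF.
  by rewrite normrZ gtr0_norm // mulrC ler_pM2l.
have [f [fn fC]] := hahn_banach_cone sp cC Cp.
exists f; split=> [u|a Aa].
  by rewrite ler_norml fn andbT lerNl -raddfN (le_trans (fn _)) // normrN.
have /fC /= : C (y - a, d).
  exists [:: (1, a)]; last by rewrite !big_seq1 scale1r mulr1.
  by move=> p; rewrite inE => /eqP ->.
by rewrite raddfB; lra.
Qed.

End Convex.

(** * The Daugavet property *)

Section Operators.
Context {R : realType} {X : normedModType R}.
Implicit Types (T : X -> X) (x u : X).

Lemma opnorm_le T (M : R) :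
  (forall x, `|x| <= 1 -> `|T x| <= M) -> opnorm T <= M.
Proof.
move=> TM; apply: ge_sup.
  by exists `|T 0|, 0 => //=; rewrite normr0.
by move=> _ [x /= x1 <-]; exact: TM.
Qed.

Lemma opnorm_has_sup T : bounded_operator T ->
  has_sup [set `|T x| | x in [set x | `|x| <= 1]].
Proof.
move=> [M TM]; split; first by exists `|T 0|, 0 => //=; rewrite normr0.
exists `|M| => _ [x /= x1 <-]; apply: le_trans (TM x) _.
apply: le_trans (ler_norm _) _.
by rewrite normrM normr_id ler_piMr.
Qed.

Lemma opnorm_ge T x : bounded_operator T -> `|x| <= 1 -> `|T x| <= opnorm T.
Proof.
move=> /opnorm_has_sup[_ ubT] x1; apply: (ub_le_sup ubT).
by exists x.
Qed.

Lemma opnorm_ge0 T : bounded_operator T -> 0 <= opnorm T.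
Proof.
by move=> bT; apply: le_trans (opnorm_ge (x := 0) bT _); rewrite ?normr0.
Qed.

Lemma opnorm_adherent T (e : R) : bounded_operator T -> 0 < e ->
  exists2 x, `|x| <= 1 & opnorm T - e < `|T x|.
Proof.
move=> /opnorm_has_sup hT /sup_adherent/(_ hT)[_ [x x1 <-]] h.
by exists x.
Qed.

Lemma opnormP (T : {linear X -> X}) x :
  bounded_operator T -> `|T x| <= opnorm T * `|x|.
Proof.
move=> bT; have [->|x0] := eqVneq x 0.
  by rewrite linear0 !normr0 mulr0.
have nx0 : 0 < `|x| by rewrite normr_gt0.
rewrite -ler_pdivrMr // mulrC -[X in X * _]gtr0_norm ?invr_gt0 // -normrZ -linearZ.
apply: opnorm_ge => //.
by rewrite normrZ gtr0_norm ?invr_gt0 // mulVf // gt_eqF.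
Qed.

Lemma bounded_operator_idD T : bounded_operator T -> bounded_operator (idfun \+ T).
Proof.
move=> [M TM]; exists (1 + M) => x /=.
by rewrite mulrDl mul1r; apply: le_trans (ler_normD _ _) _; rewrite lerD2l.
Qed.

End Operators.

Section DaugavetCriterion.
Context {R : realType} {X : normedModType R}.
Implicit Types (x y u v : X).

(** If [y] were not such a combination, it would stay at distance [e / 2] from the
    combinations of points of [lplus x (e / 2)], and a functional [f] would separate
    it from them. A point [u] at which the operator [u |-> u + f u *: x] almost
    attains its norm lies in [lplus x (e / 2)], and there [f] is almost as large
    as its norm, hence too large compared with [f y]. *)
Lemma daugavet_conv_lplus x y (e : R) : daugavet X ->
  `|x| = 1 -> `|y| = 1 -> 0 < e -> exists n, conv_n n (lplus x e) y.
Proof.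
move=> dX x1 y1 e0; apply: contrapT => /forallNP noconv.
have e20 : 0 < e / 2 by rewrite divr_gt0.
have far n z : conv_n n (lplus x (e / 2)) z -> e / 2 <= `|y - z|.
  move=> cz; rewrite leNgt; apply/negP => /ltW yz; apply: (noconv n).
  by rewrite [e]splitr; exact: conv_n_lplus_near yz.
have [f [fn fA]] := conv_separation far.
have x0 : x != 0 by rewrite -normr_gt0 x1.
have fyx : f x + e / 2 <= f y.
  apply: fA; split; first by rewrite x1; lra.
  by rewrite -mulr2n normrMn x1; lra.
pose g u : X := f u *: x.
have g0 : g 0 = 0 by rewrite /g linear0 scale0r.
have gD u v : g (u + v) = g u + g v by rewrite /g linearD scalerDl.
have gZ : scalable g by move=> a u; rewrite /g linearZ /= scalerA.
pose T : {linear X -> X} := HB.pack_for {linear X -> X} g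
  (GRing.isNmodMorphism.Build _ _ g (conj g0 gD)) (GRing.isScalable.Build _ _ _ _ g gZ).
have TE u : T u = f u *: x by [].
have Tn u : `|T u| = `|f u| by rewrite TE normrZ x1 mulr1.
have bT : bounded_operator T by exists 1 => u; rewrite Tn mul1r.
have [w fw] : exists w, f w != 0.
  exists (y - x); rewrite raddfB gt_eqF //; lra.
have rT : rank_one T.
  exists x => //; apply/seteqP; split=> [_ [u _ <-]|_ [a _ <-]] /=.
    by exists (f u).
  exists ((a / f w) *: w) => //.
  by rewrite [LHS]TE linearZ /= divfK.
pose m := opnorm T.
have m0 : 0 < m.
  have := opnormP w bT; rewrite Tn -/m => h.
  rewrite lt_def (opnorm_ge0 bT) andbT; apply: contraTneq h => ->.
  by rewrite mul0r -ltNge normr_gt0.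
have m1 : m <= 1 by apply: opnorm_le => u u1; rewrite Tn; exact: le_trans (fn u) u1.
(* The first bound keeps [f u] above [m / 2]; then the second bound makes
   [eta / f u], the defect of [`|x + u|] from 2, smaller than [e / 2]. *)
pose eta := Num.min (m / 2) (m * e / 4).
have eta0 : 0 < eta by rewrite lt_min !divr_gt0 ?mulr_gt0.
have eta1 : eta <= m / 2 by rewrite ge_min lexx.
have eta2 : eta <= m * e / 4 by rewrite ge_min lexx orbT.
have [u0 u01] := opnorm_adherent (bounded_operator_idD bT) eta0.
rewrite (dX T bT rT) -/m /= => u0T.
(* Up to replacing [u0] by [- u0]. *)
have [u [u1 fu uT]] : exists u, [/\ `|u| <= 1, 0 <= f u & 1 + m - eta < `|u + T u|].
  have [f0|f0] := leP 0 (f u0); first by exists u0.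
  exists (- u0); split; first by rewrite normrN.
    by rewrite linearN /= oppr_ge0 ltW.
  by rewrite linearN -opprD normrN.
have fum : f u <= m.
  by apply: le_trans (ler_norm _) _; rewrite -Tn; exact: opnorm_ge.
have uTle : `|u + T u| <= 1 + f u.
  by apply: le_trans (ler_normD _ _) _; rewrite Tn (ger0_norm fu) lerD2r.
have key : `|u + T u| <= f u * `|x + u| + (1 - f u).
  have -> : u + T u = f u *: (x + u) + (1 - f u) *: u.
    by rewrite TE scalerDr scalerBl scale1r addrC -addrA subrKC.
  apply: le_trans (ler_normD _ _) _.
  rewrite !normrZ (ger0_norm fu) lerD2l ger0_norm ?subr_ge0; last by lra.
  by rewrite ler_piMr // subr_ge0; lra.
have fu0 : 0 < f u by lra.
have ulplus : lplus x (e / 2) u.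
  split; first by lra.
  rewrite -(ltr_pM2l fu0); have : m / 2 * e <= f u * e by rewrite ler_pM2r //; lra.
  by rewrite mulrBr; lra.
have := fA _ ulplus.
have : f y <= m.
  by apply: le_trans (ler_norm _) _; rewrite -Tn; apply: opnorm_ge; rewrite ?y1.
have : m * e <= e by rewrite ler_piMl // ltW.
lra.
Qed.

(** By the triangle inequality, from the length of [x + u] if [r] is at most 1 and
    from that of [r *: (x + u)] otherwise. *)
Lemma lplus_norm_ge x u (e r : R) : 0 <= r -> 0 <= e -> `|x| = 1 ->
  lplus x e u -> 1 + r - e * (1 + 2 * r) <= `|u + r *: x|.
Proof.
move=> r0 e0 x1 [ue xu].
have re : 0 <= r * e by rewrite mulr_ge0.
have [r1|/ltW r1] := leP r 1.
  have -> : u + r *: x = (x + u) - (1 - r) *: x.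
    by rewrite scalerBl scale1r [x + u]addrC opprB addrACA subrr addr0.
  have := lerB_dist (x + u) ((1 - r) *: x).
  by rewrite normrZ x1 ger0_norm ?subr_ge0 //; lra.
have -> : u + r *: x = r *: (x + u) - (r - 1) *: u.
  by rewrite scalerBl scale1r scalerDr opprB addrACA subrr addr0 addrC.
have := lerB_dist (r *: (x + u)) ((r - 1) *: u).
rewrite !normrZ !ger0_norm ?subr_ge0 //.
have : r * (2 - e) <= r * `|x + u| by rewrite ler_wpM2l // ltW.
have : (r - 1) * `|u| <= (r - 1) * (1 + e) by rewrite ler_wpM2l // subr_ge0.
rewrite mulrBr !mulrDr !mulrBl mulr1; lra.
Qed.

(** Take [y] at which the functional [g] of the rank-one operator [T] is almost
    maximal, and [x] spanning the range of [T]. Written as a combination of points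
    of [lplus x e], [y] cannot have a larger [g] than all of these points; at one
    where [g] is as large, [`|a + T a|] is almost [1 + opnorm T]. *)
Lemma conv_lplus_daugavet :
  (forall x y (e : R), `|x| = 1 -> `|y| = 1 -> 0 < e ->
    exists n, conv_n n (lplus x e) y) -> daugavet X.
Proof.
move=> H T bT [v v0 rT].
have bIT := bounded_operator_idD bT.
pose N := opnorm (idfun \+ T); pose t := opnorm T; rewrite -/N -/t.
have nv0 : 0 < `|v| by rewrite normr_gt0.
pose x := `|v|^-1 *: v.
have x1 : `|x| = 1 by rewrite normrZ gtr0_norm ?invr_gt0 // mulVf ?gt_eqF.
have x0 : x != 0 by rewrite -normr_gt0 x1.
have xI a b : a *: x = b *: x -> a = b.
  by move/eqP; rewrite -subr_eq0 -scalerBl scaler_eq0 (negPf x0) orbF subr_eq0 => /eqP.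
have TE u : exists a, T u = a *: x.
  have : range T (T u) by exists u.
  rewrite rT => -[a _ <-]; exists (a * `|v|).
  by rewrite scalerA mulfK // gt_eqF.
pose g u := projT1 (cid (TE u)).
have gE u : T u = g u *: x by rewrite /g; case: cid.
have gn u : `|g u| = `|T u| by rewrite gE normrZ x1 mulr1.
have NE : N <= 1 + t.
  apply: opnorm_le => u u1 /=; apply: le_trans (ler_normD _ _) _.
  by rewrite lerD // opnorm_ge.
have t0 : 0 < t.
  rewrite lt_def (opnorm_ge0 bT) andbT; apply/negP => /eqP tE.
  have : range T v by rewrite rT; exists 1; rewrite ?scale1r.
  move=> [w _ Tw]; have := opnormP w bT.
  by rewrite Tw -/t tE mul0r leNgt nv0.
apply/eqP; rewrite eq_le NE /=; apply/ler_addgt0Pl => eta eta0.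
(* [3 + 5 * t] collects the errors below: [e] from the choice of [u], at most
   [e * (1 + 4 * t)] from [lplus_norm_ge], at most [e * (1 + t)] from
   [`|a k| <= 1 + e]. *)
pose e := Num.min 1 (Num.min (t / 2) (eta / (3 + 5 * t))).
have e0 : 0 < e.
  by rewrite !lt_min ltr01 !divr_gt0 // addr_gt0 // mulr_gt0.
have e1 : e <= 1 by rewrite ge_min lexx.
have e2 : e <= t / 2 by rewrite !ge_min lexx orbT.
have e3 : e * (3 + 5 * t) <= eta.
  by rewrite -ler_pdivlMr ?addr_gt0 ?mulr_gt0 // !ge_min lexx !orbT.
have [u0 u01 Tu0] := opnorm_adherent bT e0.
have [u [u1 gu]] : exists u, `|u| <= 1 /\ t - e < g u.
  have [g0|g0] := leP 0 (g u0).
    by exists u0; split; rewrite // -(ger0_norm g0) gn.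
  exists (- u0); rewrite normrN; split => //.
  have -> : g (- u0) = - g u0.
    by apply: xI; rewrite -gE linearN /= gE scaleNr.
  by rewrite -(ltr0_norm g0) gn.
pose y := `|u|^-1 *: u.
have u0' : 0 < `|u|.
  rewrite normr_gt0; apply: contraTneq gu => ->; rewrite -leNgt.
  suff -> : g 0 = 0 by lra.
  by apply/eqP; rewrite -normr_eq0 gn linear0 normr0.
have y1 : `|y| = 1 by rewrite normrZ gtr0_norm ?invr_gt0 // mulVf ?gt_eqF.
have Ty : T y = (g u / `|u|) *: x by rewrite /y linearZ /= gE scalerA mulrC.
have sy : t - e < g u / `|u|.
  by apply: (lt_le_trans gu); rewrite ler_peMr ?invf_ge1 //; lra.
have [n [a [w [aA w0 w1 yE]]]] := H x y e x1 y1 e0.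
(* The value [g u / `|u|] of [g] at [y] is the average of the [g (a k)]. *)
have [k gk] : exists k, g u / `|u| <= g (a k).
  apply: contrapT => /forallNP small.
  have gsum : g u / `|u| = \sum_k w k * g (a k).
    apply: xI; rewrite -Ty yE linear_sum /= scaler_suml.
    by apply: eq_bigr => k _; rewrite linearZ /= gE scalerA.
  have : \sum_k w k * g (a k) < \sum_k w k * (g u / `|u|).
    have [k wk] : exists k, 0 < w k.
      apply: contrapT => /forallNP wle.
      move: w1; rewrite big1 => [/esym/eqP|k _]; first by rewrite oner_eq0.
      by apply/eqP; rewrite eq_le w0 leNgt andbT; apply/negP.
    have lt_k j : g (a j) < g u / `|u| by rewrite ltNge; apply/negP.
    rewrite (bigD1 k) // [ltRHS](bigD1 k) //=; apply: ltr_leD.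
      by rewrite ltr_pM2l.
    by apply: ler_sum => j _; rewrite ler_wpM2l // ltW.
  by rewrite -mulr_suml w1 mul1r -gsum ltxx.
have [ae _] := aA k.
have gt2 : g (a k) <= t * (1 + e).
  apply: le_trans (ler_norm _) _; rewrite gn; apply: le_trans (opnormP _ bT) _.
  by rewrite ler_pM2l.
have lb := lplus_norm_ge _ (ltW e0) x1 (aA k).
have {}lb : 1 + g (a k) - e * (1 + 2 * g (a k)) <= `|a k + g (a k) *: x|.
  by apply: lb; lra.
have ub : `|a k + g (a k) *: x| <= N * (1 + e).
  rewrite -gE; apply: le_trans (opnormP (T := idfun \+ T) (a k) bIT) _.
  by rewrite ler_wpM2l // opnorm_ge0.
have : N * e <= (1 + t) * e by rewrite ler_pM2r.
have : e * g (a k) <= e * (2 * t).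
  rewrite ler_pM2l //; apply: le_trans gt2 _; rewrite mulrC ler_pM2r //; lra.
lra.
Qed.

(** Membership in the convex hull is exact rather than approximate; this is what
    transfers to the factors of an ultraproduct with the number of points kept. *)
Lemma daugavetP : daugavet X <->
  (forall x y (e : R), `|x| = 1 -> `|y| = 1 -> 0 < e ->
    exists n, conv_n n (lplus x e) y).
Proof.
by split=> [dX x y e|]; [exact: daugavet_conv_lplus|exact: conv_lplus_daugavet].
Qed.

End DaugavetCriterion.

(** * Ultrafilters and ultraproducts *)

Section Ultrafilter.
Context {I : Type} (U : set_system I) {UU : UltraFilter U}.

(** Countable saturation. Some decreasing sequence in [U] has an intersection
    outside [U]; off this intersection each index [i] lies in only finitely many
    of the sets, and [t i] is chosen to satisfy the strongest condition [P n i]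
    that the position of [i] in the sequence allows. *)
Lemma diagonal_choice (T : I -> Type) (P : nat -> forall i, T i -> Prop)
    (t0 : forall i, T i) :
  countably_incomplete U ->
  (forall n i t, P n.+1 i t -> P n i t) ->
  (forall n, \forall i \near U, exists t, P n i t) ->
  exists t : forall i, T i, forall n, \forall i \near U, P n i (t i).
Proof.
move=> [A [UA nUA]] PS UP.
have Pmono m n i t : (m <= n)%N -> P n i t -> P m i t.
  elim: n => [|n IH]; first by rewrite leqn0 => /eqP ->.
  by rewrite leq_eqVlt => /predU1P[-> //|mn /PS]; exact: IH.
pose B n i := (forall k, (k < n)%N -> A k i) /\ exists t, P n i t.
have UB n : \forall i \near U, B n i.
  apply: filterI (UP n); elim: n => [|n IH]; first by apply: filterE.
  apply: filterS2 (UA n) IH => i Ani Ai k; rewrite ltnS leq_eqVlt.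
  by case/predU1P => [->|]; [|exact: Ai].
have UC : U (~` \bigcap_n A n) by have [] := in_ultra_setVsetC (\bigcap_n A n) UU.
have pick i : exists t, (~` \bigcap_n A n) i -> forall n, B n i -> P n i t.
  have [[k nAk]|allA] := pselect (exists k, ~ A k i); last first.
    exists (t0 i) => /= nA; exfalso; apply: nA => k _; apply: contrapT => nAk.
    by apply: allA; exists k.
  have Bk n : `[< B n i >] -> (n <= k)%N.
    move=> /asboolP[An _]; rewrite leqNgt; apply/negP => kn.
    by apply: nAk; exact: An.
  have [[n0 Bn0]|noB] := pselect (exists n, B n i); last first.
    by exists (t0 i) => _ n Bn; case: noB; exists n.
  have exB : exists n, `[< B n i >] by exists n0; apply/asboolP.
  have [m /asboolP[_ [t Pt]] mmax] := ex_maxnP exB Bk.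
  by exists t => _ n /asboolT/mmax nm; exact: Pmono nm Pt.
exists (fun i => projT1 (cid (pick i))) => n.
by apply: filterS2 UC (UB n) => i Ci Bi; case: cid => t /=; exact.
Qed.

End Ultrafilter.

Section Ultraproduct.
Context {R : realType} {I : Type} {U : set_system I} {UU : UltraFilter U}.
Context {X : I -> completeNormedModType R}.
Implicit Types (x y : bounded_family X) (q : ultraproduct U X).

Lemma bounded_family_of (f : Defs.family X) (M : R) :
  (forall i, `|f i| <= M) -> exists x : bounded_family X, val x = f.
Proof.
move=> fM; have bf : f \in @is_bounded _ _ X by apply/asboolP; exists M.
by exists (BoundedFamily bf).
Qed.

Lemma norm_uproj_cvg x : `|val x i| @[i --> U] --> `|uproj UU x|.
Proof. by rewrite norm_uproj; exact: limnorm_cvg. Qed.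

Lemma eq_uproj x y :
  `|val x i - val y i| @[i --> U] --> (0 : R) -> uproj UU x = uproj UU y.
Proof. by move=> xy0; apply/uprojP/eqP; exact: limnorm_unique. Qed.

Lemma uproj_sumZ n (w : 'I_n -> R) (a : 'I_n -> bounded_family X) :
  uproj UU (\sum_k w k *: a k) = \sum_k w k *: uproj UU (a k).
Proof.
have uproj0 : uproj UU (0 : bounded_family X) = 0.
  by rewrite -(scale0r (0 : bounded_family X)) uprojZ scale0r.
rewrite (big_morph _ (@uprojD _ _ _ UU X) uproj0).
by apply: eq_bigr => k _; rewrite uprojZ.
Qed.

Lemma val_sumZ n (w : 'I_n -> R) (a : 'I_n -> bounded_family X) i :
  val (\sum_k w k *: a k) i = \sum_k w k *: val (a k) i.
Proof. exact: (big_morph (fun x : bounded_family X => val x i) _ _). Qed.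

(** The inverse of 0 being 0, [`|x|^-1 *: x] has norm at most 1 for every [x]. *)
Lemma uproj_unit q : `|q| = 1 ->
  exists2 x, uproj UU x = q & \forall i \near U, `|val x i| = 1.
Proof.
have [z <-] := uproj_surj q => z1.
have nz i : `| `|val z i|^-1 *: val z i| = (val z i != 0)%:R.
  have [->|z0] := eqVneq (val z i) 0; first by rewrite scaler0 normr0.
  by rewrite normrZ normfV normr_id mulVf // normr_eq0.
have [x xE] : exists x : bounded_family X, val x = fun i => `|val z i|^-1 *: val z i.
  by apply: (@bounded_family_of _ 1) => i; rewrite nz lern1 leq_b1.
have cz : `|val z i| @[i --> U] --> (1 : R) by rewrite -z1; exact: norm_uproj_cvg.
exists x.
  apply: eq_uproj; rewrite xE.
  apply: (@squeeze_cvgr _ _ _ _ (fun=> 0) (fun i => `|1 - `|val z i| |)).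
  - apply: filterE => i; rewrite normr_ge0 /=.
    have [->|z0] := eqVneq (val z i) 0; first by rewrite scaler0 subr0 normr0.
    rewrite -[X in _ - X]scale1r -scalerBl normrZ -[X in _ * X]normr_id -normrM.
    by rewrite mulrBl mul1r mulVf // normr_eq0.
  - exact: cvg_cst.
  - rewrite -[X in _ --> X](normr0 R) -(subrr (1 : R)).
    by apply: cvg_norm; apply: cvgB => //; exact: cvg_cst.
apply: filterS (cvgr_gt _ cz _ ltr01) => i zi.
by rewrite xE nz -normr_gt0 zi.
Qed.

End Ultraproduct.

(** The limit exists because a bounded function is a bounded family in the
    constant family [R], whose norms converge along [U]. *)
Lemma bounded_ultra_cvg (R : realType) (I : Type) (U : set_system I)
    (UU : UltraFilter U) (f : I -> R) (M : R) :
  (forall i, 0 <= f i <= M) -> exists l : R, f i @[i --> U] --> l.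
Proof.
move=> fM.
have [i|x xE] := @bounded_family_of R I (fun=> R^o) f M.
  by have /andP[f0] := fM i; rewrite ger0_norm.
exists (limnorm U x); rewrite (_ : f = fun i => `|val x i|); first exact: limnorm_cvg.
by apply/funext => i; rewrite xE ger0_norm //; have /andP[] := fM i.
Qed.

Section DaugavetIndex.
Context {R : realType} {X : normedModType R}.

Lemma conv_lplus_of_index n (e : R) (x y : X) :
  (daugavet_index X e < n%:R%:E)%E -> `|x| = 1 -> `|y| = 1 ->
  conv_n n (lplus x e) y.
Proof.
move=> /ereal_inf_lt[_ [m Hm <-]]; rewrite lte_fin ltr_nat => /ltnW mn x1 y1.
by apply: conv_n_le mn _ _; exact: Hm.
Qed.

Lemma index_lt_of_conv_lplus n (e : R) :
  (forall x y : X, `|x| = 1 -> `|y| = 1 -> conv_n n (lplus x e) y) ->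
  (daugavet_index X e < n.+1%:R%:E)%E.
Proof.
move=> H; apply: (@le_lt_trans _ _ n%:R%:E); last by rewrite lte_fin ltr_nat.
by apply: ereal_inf_lbound; exists n => // x x1 y y1; exact: H.
Qed.

End DaugavetIndex.

(** * Transfer of convex combinations *)

Section Transfer.
Context {R : realType} {I : Type} {U : set_system I} {UU : UltraFilter U}.
Context {X : I -> completeNormedModType R}.
Implicit Types (x y : bounded_family X).

(** The number [n] of points is the same at every index, so the weights and the
    points of the combinations can be passed to the limit one by one. *)
Lemma conv_lplus_uproj n x y (e e' : R) : e < e' ->
  (\forall i \near U, conv_n n (lplus (val x i) e) (val y i)) ->
  conv_n n (lplus (uproj UU x) e') (uproj UU y).
Proof.
move=> ee' xy; pose M := `|1 + e|.
have pick i : exists aw : ('I_n -> X i) * ('I_n -> R),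
    [/\ forall k, `|aw.1 k| <= M, forall k, 0 <= aw.2 k <= 1 &
    conv_n n (lplus (val x i) e) (val y i) ->
    [/\ forall k, lplus (val x i) e (aw.1 k), \sum_k aw.2 k = 1 &
        val y i = \sum_k aw.2 k *: aw.1 k]].
  have [[a [w [xa w0 w1 yE]]]|nc] := pselect (conv_n n (lplus (val x i) e) (val y i)).
    exists (a, w); split=> //= k.
      by have [ae _] := xa k; exact: le_trans ae (ler_norm _).
    by rewrite w0 -w1 (bigD1 k) //= lerDl sumr_ge0.
  by exists (fun=> 0, fun=> 0); split=> // k /=; rewrite ?normr0 ?normr_ge0 ?lexx ?ler01.
pose aw i := projT1 (cid (pick i)).
have awP i := projT2 (cid (pick i)); rewrite -/(aw _) in awP.
have bounded k : exists b : bounded_family X, val b = fun i => (aw i).1 k.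
  by apply: (@bounded_family_of _ _ _ _ M) => i; have [] := awP i.
pose a k := projT1 (cid (bounded k)).
have aE k i : val (a k) i = (aw i).1 k by rewrite /a; case: cid => b /= ->.
have limit k : exists l : R, (aw i).2 k @[i --> U] --> l.
  by apply: (@bounded_ultra_cvg _ _ _ _ _ 1) => i; have [] := awP i.
pose w k := projT1 (cid (limit k)).
have wE k : (aw i).2 k @[i --> U] --> w k := projT2 (cid (limit k)).
exists (fun k => uproj UU (a k)), w; split.
- move=> k; split.
    apply: (cvgr_to_le (norm_uproj_cvg (x := a k))).
    apply: filterS xy => i /(let: And3 _ _ h := awP i in h)[lp _ _].
    by have [] := lp k; rewrite aE; lra.
  apply: (@lt_le_trans _ _ (2 - e)); first by lra.
  rewrite -uprojD; apply: (cvgr_to_ge (norm_uproj_cvg (x := x + a k))).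
  apply: filterS xy => i /(let: And3 _ _ h := awP i in h)[lp _ _].
  by have [_ /ltW] := lp k; rewrite -aE.
- move=> k; apply: (cvgr_to_ge (wE k)); apply: filterE => i.
  by have [_ /(_ k)/andP[]] := awP i.
- have sw : \sum_k (aw i).2 k @[i --> U] --> \sum_k w k.
    by apply: cvg_big => [|k _]; [exact: add_continuous|exact: wE].
  have s1 : \sum_k (aw i).2 k @[i --> U] --> (1 : R).
    apply: cvg_near_cst.
    by apply: filterS xy => i /(let: And3 _ _ h := awP i in h)[].
  exact: (cvg_unique _ sw s1).
- rewrite -uproj_sumZ; apply: eq_uproj.
  apply: (@squeeze_cvgr _ _ _ _ (fun=> 0)
    (fun i => \sum_k `|(aw i).2 k - w k| * M)).
  + apply: filterS xy => i /(let: And3 _ _ h := awP i in h)[_ _ yE].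
    rewrite normr_ge0 /= yE val_sumZ -sumrB.
    apply: le_trans (ler_norm_sum _ _ _) _; apply: ler_sum => k _.
    rewrite aE -scalerBl normrZ ler_wpM2l //.
    by have [] := awP i.
  + exact: cvg_cst.
  + have c : \sum_k `|(aw i).2 k - w k| * M @[i --> U] --> \sum_k `|w k - w k| * M.
      apply: cvg_big => [|k _]; first exact: add_continuous.
      apply: cvgM; last exact: cvg_cst.
      by apply: cvg_norm; apply: cvgB; [exact: wE|exact: cvg_cst].
    rewrite [X in _ --> X](_ : _ = 0) in c; first exact: c.
    by rewrite big1 // => k _; rewrite subrr normr0 mul0r.
Qed.

(** At [U]-almost every index the chosen representatives give a combination of
    points of [lplus] close to [val y i]; translating these points by the error
    makes it exact. *)
Lemma conv_lplus_near_of_uproj n x y (e e' : R) : e < e' ->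
  conv_n n (lplus (uproj UU x) e) (uproj UU y) ->
  \forall i \near U, conv_n n (lplus (val x i) e') (val y i).
Proof.
move=> ee' [a [w [xa w0 w1 yE]]].
pose d := (e' - e) / 2; have d0 : 0 < d by rewrite divr_gt0 // subr_gt0.
pose b k := projT1 (cid (uproj_surj (a k))).
have bE k : uproj UU (b k) = a k := projT2 (cid (uproj_surj (a k))).
have near_b : \forall i \near U, forall k, lplus (val x i) (e + d) (val (b k) i).
  apply: filter_forall => k; have [ae xae] := xa k.
  have cb : `|val (b k) i| @[i --> U] --> `|a k|.
    by rewrite -bE; exact: norm_uproj_cvg.
  have cxb : `|val (x + b k) i| @[i --> U] --> `|uproj UU x + a k|.
    by rewrite -bE -uprojD; exact: norm_uproj_cvg.
  apply: filterS2 (cvgr_lt _ cb (1 + (e + d)) _) (cvgr_gt _ cxb (2 - (e + d)) _).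
  - by move=> i /ltW bi xbi; split.
  - by lra.
  - by lra.
pose z := y - \sum_k w k *: b k.
have cz : `|val z i| @[i --> U] --> (0 : R).
  have -> : (0 : R) = `|uproj UU z|; last exact: norm_uproj_cvg.
  rewrite /z -scaleN1r uprojD uprojZ uproj_sumZ scaleN1r yE.
  by under [X in _ - X]eq_bigr do rewrite bE; rewrite subrr normr0.
apply: filterS2 near_b (cvgr_lt _ cz _ d0) => i bi zi.
have -> : e' = e + d + d by rewrite /d; lra.
apply: (@conv_n_lplus_near _ _ _ _ _ (\sum_k w k *: val (b k) i)).
  by exists (fun k => val (b k) i), w.
by rewrite -val_sumZ; exact: ltW.
Qed.

End Transfer.

Unset Implicit Arguments.
Set Strict Implicit.

Theorem theorem6p4 (R : realType) (I : Type) (U : set_system I)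
    (UU : UltraFilter U) (U_ci : countably_incomplete U)
    (X : I -> completeNormedModType R) :
  daugavet (ultraproduct U X) <->
  (forall e : R, 0 < e ->
    exists n : nat, U [set i | (daugavet_index (X i) e < n%:R%:E)%E]).
Proof.
split=> [/daugavetP dX e e0|H].
  apply: contrapT => /forallNP noU.
  (* The indices are unbounded along [U], so pairs of unit vectors can be chosen
     that fail with more and more points; their classes fail with any number. *)
  pose P n i (p : X i * X i) :=
    [/\ `|p.1| = 1, `|p.2| = 1 & ~ conv_n n (lplus p.1 e) p.2].
  have [n i p [p1 p2 np]|n|t tP] := diagonal_choice (P := P) (fun i => (0, 0)) U_ci.
  - by split=> // c; apply: np; exact: conv_n_le c.
  - have [/noU //|] := in_ultra_setVsetC
      [set i | (daugavet_index (X i) e < n.+1%:R%:E)%E] UU.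
    apply: filterS => i; apply: contra_notP => /forallNP nP.
    apply: index_lt_of_conv_lplus => x y x1 y1; apply: contrapT => nc.
    by apply: (nP (x, y)).
  have unit_family (s : forall i, X i) : (\forall i \near U, `|s i| = 1) ->
      exists x : bounded_family X,
        `|uproj UU x| = 1 /\ \forall i \near U, val x i = s i.
    move=> s1.
    have [i|x xE] := @bounded_family_of _ _ X
        (fun i => if `|s i| == 1 then s i else 0) 1.
      by case: eqP => [->|_] //; rewrite normr0.
    have xs : \forall i \near U, val x i = s i.
      by apply: filterS s1 => i si; rewrite xE si eqxx.
    exists x; split=> //.
    have x1 : `|val x i| @[i --> U] --> (1 : R).
      by apply: cvg_near_cst; apply: filterS2 xs s1 => i ->.
    exact: (cvg_unique _ (norm_uproj_cvg (x := x)) x1).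
  have [|x [x1 xE]] := unit_family (fun i => (t i).1).
    by apply: filterS (tP 0%N) => i [].
  have [|y [y1 yE]] := unit_family (fun i => (t i).2).
    by apply: filterS (tP 0%N) => i [].
  have [n cn] := dX _ _ (e / 2) x1 y1 (divr_gt0 e0 (ltr0n _ 2)).
  have e2e : e / 2 < e by lra.
  have [i [ci [xi [yi [_ _ /=]]]]] := filter_ex
    (filterI (conv_lplus_near_of_uproj e2e cn) (filterI xE (filterI yE (tP n)))).
  by rewrite -xi -yi.
apply/daugavetP => q r e q1 r1 e0.
have e20 : 0 < e / 2 by rewrite divr_gt0.
have [n Un] := H _ e20.
have [x <- x1] := uproj_unit q1; have [y <- y1] := uproj_unit r1.
exists n; apply: (@conv_lplus_uproj _ _ _ _ _ _ _ _ (e / 2)); first by lra.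
apply: filterS2 Un (filterI x1 y1) => i Di [xi yi].
exact: conv_lplus_of_index.
Qed.
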